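(* Let $G$ be a Lie group and let $\mathfrak g_2=\mathfrak g$ act on $TT^*G\simeq(G\circledS\mathfrak g_1^* )\circledS(\mathfrak g_2\circledS\mathfrak g_3^* )$, with the Tulczyjew symplectic form, by $((g,\mu,\xi,\nu);\eta)\mapsto(g,\mu,\xi+\eta,\nu)$, with momentum map $\mathbf J^{\mathfrak g_2}_{TT^*G}:TT^*G\to\mathfrak g^*$, $(g,\mu,\xi,\nu)\mapsto\mu$. The symplectic reduction of $TT^*G$ under this action at $\mu\in\mathfrak g^*$ gives the reduced space $$\big(\mathbf J^{\mathfrak g_2}_{TT^*G}\big)^{-1}(\mu)\big/\mathfrak g_2\simeq G\circledS\mathfrak g_3^*$$ with the canonical symplectic two-form $\Omega_{G\circledS\mathfrak g_3^*}$.
   Context: $G$ is a (finite-dimensional) Lie group with identity $e$, $\mathfrak g=T_eG$; $\mathfrak g_i,\mathfrak g_i^*$ are copies of $\mathfrak g,\mathfrak g^*$. $R_g$ is right multiplication; $\mathrm{Ad}_g=T_e(h\mapsto ghg^{-1})$, $[\xi,\eta]=\frac{d}{dt}|_{t=0}\mathrm{Ad}_{\exp t\xi}\eta$, $\langle\mathrm{ad}^*_\xi\mu,\eta\rangle=-\langle\mu,[\xi,\eta]\rangle$. $T^*G$ is identified with $G\circledS\mathfrak g^*$ by $\alpha_g\mapsto(g,T_e^*R_g\alpha_g)$; the canonical form $d\theta$ ($\theta$ the Liouville form) becomes $\Omega_{G\circledS\mathfrak g^*}$, whose value at $(g,\nu)$ on $(T_eR_ga,\delta\nu),(T_eR_g\bar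 a,\delta\bar\nu)$ is $\langle\delta\nu,\bar a\rangle-\langle\delta\bar\nu,a\rangle+\langle\nu,[a,\bar a]\rangle$. $TT^*G=T(G\circledS\mathfrak g^* )$ is identified with $G\times\mathfrak g_1^*\times\mathfrak g_2\times\mathfrak g_3^*$ by sending $(V_g,V_\mu)$ at $(g,\mu)$ to $(g,\mu,\xi,\nu)$, $\xi=T_gR_{g^{-1}}V_g$, $\nu=V_\mu-\mathrm{ad}^*_\xi\mu$. The Tulczyjew form $\Omega_{TT^*G}$ is the tangent (complete) lift of the canonical form of $T^*G$, transported by this map: on vectors $(T_eR_ga,\delta\mu,\delta\xi,\delta\nu)$, $(T_eR_g\bar a,\delta\bar\mu,\delta\bar\xi,\delta\bar\nu)$ at $(g,\mu,\xi,\nu)$ it equals $\langle\delta\nu,\bar a\rangle-\langle\delta\bar\nu,a\rangle+\langle\nu,[a,\bar a]\rangle+\langle\delta\mu,\delta\bar\xi\rangle-\langle\delta\bar\mu,\delta\xi\rangle$. Momentum maps satisfy $i_{X_\eta}\Omega=-d\langle\mathbf J,\eta\rangle$, $X_\eta$ the infinitesimal generator. *)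

(* Defs.v *)
From HB Require Import structures.
From mathcomp Require Import all_boot all_order all_algebra generic_quotient.
From mathcomp Require Import all_classical all_reals all_analysis.
Set Implicit Arguments.
Unset Strict Implicit.
Unset Printing Implicit Defensive.
Import Order.TTheory GRing.Theory Num.Theory.
Import numFieldNormedType.Exports.
Local Open Scope classical_set_scope.
Local Open Scope ring_scope.
Local Open Scope quotient_scope.

(* Smoothness is only used between finite-dimensional spaces and on open sets,
   where having all iterated directional derivatives differentiable is C^oo. *)
Fixpoint Ck {R : realType} (k : nat) {V W : normedModType R}
    (U : set V) (f : V -> W) : Prop :=
  match k with
  | 0 => forall x, U x -> {for x, continuous f}
  | k'.+1 => (forall x, U x -> differentiable f x) /\
             forall v, Ck k' U ('D_v f)
  end.

Definition smooth_on {R : realType} {V W : normedModType R}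
  (U : set V) (f : V -> W) : Prop := forall k, Ck k U f.

(* A chart is a local homeomorphism given by total functions; only the values of
   [fwd] on [dom] and of [bwd] on [fwd @` dom] matter. *)
Record chart {R : realType} (M : topologicalType) (E : normedModType R) :=
  Chart { dom : set M; fwd : M -> E; bwd : E -> M }.

Definition is_chart {R : realType} (M : topologicalType) (E : normedModType R)
    (c : chart M E) : Prop :=
  [/\ open (dom c), open (fwd c @` dom c),
      forall x, dom c x -> bwd c (fwd c x) = x,
      forall x, dom c x -> {for x, continuous (fwd c)} &
      forall y, (fwd c @` dom c) y -> {for y, continuous (bwd c)}].

(* An atlas is presented as a choice, for every point p, of a chart around p.
   The tangent space at p is then the model space E, a vector of E being the
   coordinate expression of a tangent vector in the chart chosen at p. *)
Definition atlas {R : realType} (M : topologicalType) (E : normedModType R) :=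
  M -> chart M E.

Definition manifold {R : realType} (M : topologicalType) (E : normedModType R)
    (A : atlas M E) : Prop :=
  [/\ hausdorff_space M, @second_countable M,
      forall p, is_chart (A p) /\ dom (A p) p &
      forall p q, smooth_on (fwd (A p) @` (dom (A p) `&` dom (A q)))
                            (fwd (A q) \o bwd (A p))].

Section maps.
Context {R : realType} {M N : topologicalType} {E F : normedModType R}.
Variables (A : atlas M E) (B : atlas N F).

Definition loc_repr (f : M -> N) (p : M) : E -> F :=
  fwd (B (f p)) \o f \o bwd (A p).

Definition smooth_map (f : M -> N) : Prop :=
  continuous f /\
  forall p, smooth_on (fwd (A p) @` (dom (A p) `&` f @^-1` dom (B (f p))))
                      (loc_repr f p).

Definition tangent (f : M -> N) (p : M) : E -> F :=
  'd (loc_repr f p) (fwd (A p) p).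

End maps.

Definition diffeomorphism {R : realType} {M N : topologicalType}
    {E F : normedModType R} (A : atlas M E) (B : atlas N F) (f : M -> N) : Prop :=
  smooth_map A B f /\
  exists g : N -> M, [/\ smooth_map B A g, cancel f g & cancel g f].

Definition vec_atlas {R : realType} (V : normedModType R) : atlas V V :=
  fun=> Chart setT id id.

Arguments vec_atlas {R} V.

Definition prod_atlas {R : realType} {M N : topologicalType}
    {E F : normedModType R} (A : atlas M E) (B : atlas N F) :
    atlas (M * N)%type (E * F)%type :=
  fun p => Chart (dom (A p.1) `*` dom (B p.2))
                 (fun x => (fwd (A p.1) x.1, fwd (B p.2) x.2))
                 (fun y => (bwd (A p.1) y.1, bwd (B p.2) y.2)).

(* A field of binary functions on the tangent spaces. *)
Definition form2 {R : realType} (M : topologicalType) (E : normedModType R) :=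
  M -> E -> E -> R.

Definition pullback {R : realType} {M N : topologicalType}
    {E F : normedModType R} (A : atlas M E) (B : atlas N F) (f : M -> N)
    (w : form2 N F) : form2 M E :=
  fun p u v => w (f p) (tangent A B f p u) (tangent A B f p v).

HB.mixin Record isLieGroup (R : realType) (n : nat) G
    of Topological G & Group G := {
  lie_atlas : atlas G 'rV[R]_n;
  lie_manifold : manifold lie_atlas;
  lie_mul_smooth : smooth_map (prod_atlas lie_atlas lie_atlas) lie_atlas
                     (fun x : G * G => (x.1 * x.2)%g);
  lie_inv_smooth : smooth_map lie_atlas lie_atlas (fun x : G => (x^-1)%g) }.

#[short(type="lieGroupType")]
HB.structure Definition LieGroup (R : realType) (n : nat) :=
  { G of Topological G & Group G & isLieGroup R n G }.

Section lie_algebra.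
Context {R : realType} {n : nat} (G : lieGroupType R n).
Local Notation A := (@lie_atlas R n G).

(* T_gR_(g^-1) : T_gG -> T_eG = 'rV_n. *)
Definition right_triv (g : G) : 'rV[R]_n -> 'rV[R]_n :=
  tangent A A (fun h : G => (h * g^-1)%g) g.

Definition Ad (g : G) : 'rV[R]_n -> 'rV[R]_n :=
  tangent A A (fun h : G => (g * h * g^-1)%g) 1%g.

Definition one_parameter_subgroup (xi : 'rV[R]_n) : set (R^o -> G) :=
  [set c : R^o -> G | [/\ smooth_map (vec_atlas R^o) A c,
               forall s t, c (s + t) = (c s * c t)%g &
               tangent (vec_atlas R^o) A c 0 1 = xi]].

Definition lie_exp (xi : 'rV[R]_n) : G :=
  xget (fun=> 1%g) (one_parameter_subgroup xi) 1.

Definition bracket (xi eta : 'rV[R]_n) : 'rV[R]_n :=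
  'D_1 (fun t : R^o => Ad (lie_exp (t *: xi)) eta) 0.

End lie_algebra.

(* Row vectors are the Lie algebra g = T_eG, column vectors its dual g^*. *)
Definition pairing {R : realType} {n : nat} (mu : 'cV[R]_n) (xi : 'rV[R]_n) : R :=
  (xi *m mu) 0 0.

Section iterated_bundles.
Context {R : realType} {n : nat} (G : lieGroupType R n).
Local Notation g := 'rV[R]_n.
Local Notation g' := 'cV[R]_n.
Local Notation A := (@lie_atlas R n G).

(* T^*G, right trivialized as G x g^*. *)
Definition cotangent_atlas : atlas (G * g')%type (g * g')%type :=
  prod_atlas A (vec_atlas g').

(* TT^*G, trivialized as G x g_1^* x g_2 x g_3^*: the vector (V_g, V_mu) at
   (g, mu) is (g, mu, xi, nu) with xi = T_gR_(g^-1) V_g and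
   nu = V_mu - ad^*_xi mu. *)
Definition tulczyjew_atlas :
    atlas (G * g' * g * g')%type (g * g' * g * g')%type :=
  prod_atlas (prod_atlas (prod_atlas A (vec_atlas g')) (vec_atlas g))
             (vec_atlas g').

(* The canonical two-form of T^*G in right trivialization, on the vectors
   (T_eR_h a, dnu) and (T_eR_h a', dnu'). *)
Definition canonical_form : form2 (G * g')%type (g * g')%type :=
  fun x u v =>
    let: (h, nu) := x in
    let: (a, dnu) := (right_triv h u.1, u.2) in
    let: (a', dnu') := (right_triv h v.1, v.2) in
    pairing dnu a' - pairing dnu' a + pairing nu (bracket G a a').

(* The tangent lift to TT^*G of the canonical two-form of T^*G, in the
   trivialization above, on the vectors (T_eR_h a, dmu, dxi, dnu) and
   (T_eR_h a', dmu', dxi', dnu'). *)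
Definition tulczyjew_form : form2 (G * g' * g * g')%type (g * g' * g * g')%type :=
  fun x u v =>
    let: (h, _, _, nu) := x in
    let: (a, dmu, dxi, dnu) := (right_triv h u.1.1.1, u.1.1.2, u.1.2, u.2) in
    let: (a', dmu', dxi', dnu') :=
      (right_triv h v.1.1.1, v.1.1.2, v.1.2, v.2) in
    pairing dnu a' - pairing dnu' a + pairing nu (bracket G a a')
    + pairing dmu dxi' - pairing dmu' dxi.

End iterated_bundles.

Arguments cotangent_atlas {R n} G.
Arguments tulczyjew_atlas {R n} G.
Arguments canonical_form {R n} G.
Arguments tulczyjew_form {R n} G.

(* Actions of the additive group of a vector space. *)
Record vec_action {R : realType} (V : normedModType R) (P : Type) := VecAction {
  act :> P -> V -> P;
  act0 : forall x, act x 0 = x;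
  actD : forall x a b, act x (a + b) = act (act x a) b }.

Section translation.
Context {R : realType} {n : nat} (G : lieGroupType R n).
Local Notation P := (G * 'cV[R]_n * 'rV[R]_n * 'cV[R]_n)%type.

Definition translate_fun (x : P) (eta : 'rV[R]_n) : P :=
  let: (g, mu, xi, nu) := x in (g, mu, xi + eta, nu).

Fact translate0 x : translate_fun x 0 = x.
Proof. by move: x => [[[g mu] xi] nu] /=; rewrite addr0. Qed.

Fact translateD x a b :
  translate_fun x (a + b) = translate_fun (translate_fun x a) b.
Proof. by move: x => [[[g mu] xi] nu] /=; rewrite addrA. Qed.

Definition translate : vec_action 'rV[R]_n P := VecAction translate0 translateD.

Definition momentum (x : P) : 'cV[R]_n := let: (_, mu, _, _) := x in mu.

End translation.

Arguments translate {R n} G.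
Arguments momentum {R n} G.

Section hamiltonian.
Context {R : realType} {n : nat} {P : topologicalType} {E : normedModType R}.
Variables (A : atlas P E) (Omega : form2 P E).
Variables (Phi : vec_action 'rV[R]_n P) (J : P -> 'cV[R]_n).

Definition generator (eta : 'rV[R]_n) (p : P) : E :=
  tangent (vec_atlas R^o) A (fun t : R^o => Phi p (t *: eta)) 0 1.

(* The acting group is abelian: its coadjoint action is trivial, so that
   equivariance of [J] means invariance. *)
Record momentum_map : Prop := {
  action_smooth : smooth_map (prod_atlas A (vec_atlas 'rV[R]_n)) A
                    (fun z : P * 'rV[R]_n => Phi z.1 z.2);
  action_symplectic : forall eta, pullback A A (Phi^~ eta) Omega = Omega;
  momentum_smooth : smooth_map A (vec_atlas 'cV[R]_n) J;
  momentum_equivariant : forall p eta, J (Phi p eta) = J p;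
  momentum_generator : forall p eta v,
    Omega p (generator eta p) v =
    - tangent A (vec_atlas R^o) (fun x => pairing (J x) eta : R^o) p v }.

End hamiltonian.

Section reduction.
Context {R : realType} {n : nat} {P : topologicalType}.
Variables (Phi : vec_action 'rV[R]_n P) (J : P -> 'cV[R]_n) (mu : 'cV[R]_n).

(* J^-1(mu), with the subspace topology. *)
Definition level : topologicalType := set_type (J @^-1` [set mu]).

Definition level_incl (x : level) : P := val x.

Definition same_orbit : rel level :=
  fun x y => `[< exists eta, Phi (level_incl x) eta = level_incl y >].

Fact same_orbit_refl : reflexive same_orbit.
Proof. by move=> x; apply/asboolP; exists 0; rewrite act0. Qed.

Fact same_orbit_sym : symmetric same_orbit.
Proof.
have H x y : same_orbit x y -> same_orbit y x.
  move=> /asboolP[a xy]; apply/asboolP; exists (- a).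
  by rewrite -xy -actD subrr act0.
by move=> x y; apply/idP/idP; exact: H.
Qed.

Fact same_orbit_trans : transitive same_orbit.
Proof.
move=> y x z /asboolP[a xy] /asboolP[b yz]; apply/asboolP.
by exists (a + b); rewrite actD xy yz.
Qed.

Canonical same_orbit_equiv :=
  EquivRel same_orbit same_orbit_refl same_orbit_sym same_orbit_trans.

(* The coadjoint isotropy group of mu is the whole (abelian) acting group. *)
Definition reduced_space : topologicalType :=
  quotient_topology {eq_quot same_orbit}.

Definition reduced_proj (x : level) : reduced_space := \pi_{eq_quot same_orbit} x.

End reduction.

(* [AL] makes the level set an embedded submanifold, [AQ] makes the orbit
   projection a submersion, and [omega] is the reduced form: these conditions
   determine the two smooth structures and [omega]. *)
Record symplectic_reduction {R : realType} {n : nat} {P : topologicalType}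
    {E EL EQ : normedModType R} (A : atlas P E) (Omega : form2 P E)
    (Phi : vec_action 'rV[R]_n P) (J : P -> 'cV[R]_n) (mu : 'cV[R]_n)
    (AL : atlas (level J mu) EL) (AQ : atlas (reduced_space Phi J mu) EQ)
    (omega : form2 (reduced_space Phi J mu) EQ) : Prop := {
  level_manifold : manifold AL;
  level_incl_smooth : smooth_map AL A (@level_incl _ _ _ J mu);
  level_incl_immersion : forall x, injective (tangent AL A (@level_incl _ _ _ J mu) x);
  reduced_manifold : manifold AQ;
  reduced_proj_smooth : smooth_map AL AQ (@reduced_proj _ _ _ Phi J mu);
  reduced_proj_submersion : forall x w,
    exists u, tangent AL AQ (@reduced_proj _ _ _ Phi J mu) x u = w;
  reduced_form : pullback AL AQ (@reduced_proj _ _ _ Phi J mu) omega =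
                 pullback AL A (@level_incl _ _ _ J mu) Omega }.

(* Main.v *)
(* The level set of (g, mu, xi, nu) |-> mu is G x g_2 x g_3^*, on which g_2 acts by
   translation of the middle factor, so (g, nu) are global coordinates on the
   quotient. The smooth structures are transported along these identifications;
   the inclusion, the projection and the translations are then affine in the
   charts, with constant tangent maps. On vectors with dmu = 0 the two terms of
   the Tulczyjew form involving dxi vanish, and what is left is the canonical form
   at (g, nu); on the vector (0, 0, eta, 0) only the term - <dmu', eta> survives,
   which is the momentum map equation. *)
Require Import Defs.
From HB Require Import structures.
From mathcomp Require Import all_boot all_order all_algebra generic_quotient.
From mathcomp Require Import all_classical all_reals all_analysis.
Set Implicit Arguments.
Unset Strict Implicit.
Unset Printing Implicit Defensive.
Import Order.TTheory GRing.Theory Num.Theory.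
Import numFieldNormedType.Exports.
Local Open Scope classical_set_scope.
Local Open Scope ring_scope.

(** * Calculus *)

Section differentiation.
Context {R : realType}.
Implicit Types U V W : normedModType R.

(** The first-order expansion of [f] at [x] is also one of [g], since the remainder only depends on
    germs; uniqueness of the differential does the rest. *)
Lemma near_eq_diff V W (f g : V -> W) (x : V) :
  (\near x, f x = g x) -> differentiable f x ->
  differentiable g x /\ 'd g x = 'd f x :> (V -> W).
Proof.
move=> fg df; have [dfc dfo] := (diff_locallyP _ _).1 df.
have dgo : g \o shift x = cst (g x) + 'd f x +o_ 0 id.
  apply/eqaddoP => e e0; move/eqaddoP: dfo => /(_ e e0).
  rewrite -(nbhs_singleton fg) => fo.
  move: fg; rewrite (near_shift 0 x) subr0 /= => fg.
  near=> y; have <- : (f \o shift x - (cst (f x) + 'd f x)) y =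
                      (g \o shift x - (cst (f x) + 'd f x)) y.
    by congr (_ - _); near: y.
  by near: y.
have dg := diff_unique dfc dgo.
by split => //; apply/diff_locallyP; rewrite dg; split.
Unshelve. all: by end_near.
Qed.

(** Openness of [U] turns agreement on [U] into agreement of germs at each of its points, so the
    directional derivatives agree on [U] too and the induction goes on. *)
Lemma Ck_eq V W k (U : set V) (f g : V -> W) :
  open U -> {in U, f =1 g} -> Ck k U f -> Ck k U g.
Proof.
move=> oU; elim: k f g => [|k IH] f g fg /=.
  move=> cf x Ux; have fgx : \near x, f x = g x.
    by near=> y; apply: fg; rewrite inE; near: y; exact: open_nbhs_nbhs.
  rewrite /prop_for /continuous_at -(nbhs_singleton fgx).
  exact: cvg_trans (near_eq_cvg fgx) (cf x Ux).
move=> [df ckf]; have fgx x : U x -> \near x, f x = g x.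
  by move=> Ux; near=> y; apply: fg; rewrite inE; near: y; exact: open_nbhs_nbhs.
split => [x Ux|v]; first by case: (near_eq_diff (fgx x Ux) (df x Ux)).
apply: IH (ckf v) => x; rewrite inE => Ux; exact: near_eq_derive (fgx x Ux).
Unshelve. all: by end_near. Qed.

Lemma Ck_cst V W k (A : set V) (c : W) : Ck k A (fun=> c).
Proof.
elim: k c => [|k IH] c /=; first by move=> x _; exact: cst_continuous.
split=> [x _|v]; first exact: differentiable_cst.
by rewrite (_ : 'D_v _ = fun=> 0) //; apply/funext => x; exact: derive_cst.
Qed.

Lemma linear_diff V W (L : V -> W) : linear L -> continuous L ->
  forall x, differentiable L x /\ 'd L x = L :> (V -> W).
Proof.
move=> linL cL x; pose LM := GRing.isLinear.Build _ _ _ _ _ linL.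
pose LL : {linear V -> W} := HB.pack L LM.
by split; [exact: (@linear_differentiable _ _ _ LL)|exact: (@diff_lin _ _ _ LL)].
Qed.

Lemma affine_diff V W (L : V -> W) (c : W) : linear L -> continuous L ->
  forall x, differentiable (fun y => L y + c) x /\
            'd (fun y => L y + c) x = L :> (V -> W).
Proof.
move=> linL cL x; have [dL dLE] := linear_diff linL cL x.
have dc : differentiable (cst c : V -> W) x := differentiable_cst _ _.
split; first exact: (differentiableD dL dc).
rewrite [LHS](diffD dL dc) /= dLE diff_cst; apply/funext => y.
by rewrite -[LHS]/(L y + 0) addr0.
Qed.

Lemma Ck_affine V W k (A : set V) (L : V -> W) (c : W) :
  linear L -> continuous L -> Ck k A (fun x => L x + c).
Proof.
move=> linL cL; case: k => [|k] /=.
  move=> x _; apply: differentiable_continuous.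
  by case: (affine_diff c linL cL x).
split=> [x _|v]; first by case: (affine_diff c linL cL x).
(* The derivative along [v] is constant, so no induction on [k] is required. *)
rewrite (_ : 'D_v _ = fun=> L v); first exact: Ck_cst.
apply/funext => x; have [dx dE] := affine_diff c linL cL x.
by rewrite deriveE // dE.
Qed.

(** With a linear inner map the chain rule reads ['D_v (f \o L) = 'D_(L v) f \o L] on [A], again a
    composite with [L], so the induction closes without a product rule. Below, [L] is a projection
    of a product. *)
Lemma Ck_comp_linear U V W k (A : set U) (B : set V) (f : V -> W) (L : U -> V) :
  linear L -> continuous L -> (forall x, A x -> B (L x)) -> open A ->
  Ck k B f -> Ck k A (f \o L).
Proof.
move=> linL cL AB oA; elim: k f => [|k IH] f /=.
  by move=> cf x /AB /cf; apply: continuous_comp; exact: cL.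
move=> [df ckf]; split=> [x Ax|v].
  by apply: differentiable_comp; [case: (linear_diff linL cL x)|exact/df/AB].
apply: Ck_eq oA _ (IH _ (ckf (L v))) => x; rewrite inE => Ax /=.
have [dL dLE] := linear_diff linL cL x; have dfx := df _ (AB _ Ax).
rewrite !deriveE //; last exact: differentiable_comp.
by have -> := diff_comp dL dfx; rewrite /= dLE.
Qed.

Lemma Ck_pair U V W k (A : set U) (f : U -> V) (g : U -> W) : open A ->
  Ck k A f -> Ck k A g -> Ck k A (fun x => (f x, g x)).
Proof.
move=> oA; elim: k f g => [|k IH] f g /=.
  by move=> cf cg x Ax; apply: cvg_pair; [exact: cf|exact: cg].
move=> [df ckf] [dg ckg]; split=> [x Ax|v].
  by apply: differentiable_pair; [exact: df|exact: dg].
apply: Ck_eq oA _ (IH _ _ (ckf v) (ckg v)) => x; rewrite inE => Ax.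
have [dfx dgx] := (df x Ax, dg x Ax).
by rewrite !deriveE ?diff_pair //; exact: differentiable_pair.
Qed.

End differentiation.

(** * Products and homeomorphic copies *)

Section topology.
Implicit Types M N : topologicalType.

Lemma open_setX M N (A : set M) (B : set N) :
  open A -> open B -> open (A `*` B).
Proof.
rewrite !openE => oA oB [x y] [/= Ax By]; exists (A, B) => //=.
by split; [exact: oA|exact: oB].
Qed.

Lemma second_countable_homeo M N (h : M -> N) (k : N -> M) :
  continuous h -> continuous k -> cancel h k ->
  @second_countable N -> @second_countable M.
Proof.
move=> ch ck hk [B cB [oB nB]]; exists [set h @^-1` b | b in B].
  exact: sub_countable (card_image_le _ _) cB.
split=> [_ [b Bb <-]|x W Wx].
  by move/continuousP: ch; apply; exact: oB.
have kW : nbhs (h x) (k @^-1` W) by apply: ck; rewrite hk.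
have [b [Bb bhx] bW] := nB (h x) _ kW.
exists (h @^-1` b); first by split=> //; exists b.
by move=> y /= /bW /=; rewrite hk.
Qed.

Lemma second_countable_prod M N :
  @second_countable M -> @second_countable N -> @second_countable (M * N)%type.
Proof.
move=> [B cB [oB nB]] [C cC [oC nC]].
exists [set bc.1 `*` bc.2 | bc in B `*` C].
  exact: sub_countable (card_image_le _ _) (countableX cB cC).
split=> [_ [[b c] [/= Bb Cc] <-]|[x y] W [[U V] [/= Ux Vy] UVW]].
  by apply: open_setX; [exact: oB|exact: oC].
have [b [Bb bx] bU] := nB x _ Ux; have [c [Cc cy] cV] := nC y _ Vy.
exists (b `*` c); first by split=> //; exists (b, c).
by move=> [x' y'] [/= /bU ? /cV ?]; exact: UVW.
Qed.

(** A countable base is given by the balls with rational centre and radius [k.+1%:R^-1]. *)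
Lemma second_countable_mx (R : realType) m n : @second_countable 'M[R]_(m, n).
Proof.
pose b (qk : 'M[rat]_(m, n) * nat) : set 'M[R]_(m, n) :=
  ball (map_mx ratr qk.1 : 'M[R]_(m, n)) qk.2.+1%:R^-1.
exists (range b); first exact: sub_countable (card_image_le _ _) (countableP _).
split=> [_ [qk _ <-]|x V /nbhs_ballP[_/posnumP[e] eV]]; first exact: ball_open.
(* The radius is taken below [e / 2]: a ball of that radius whose centre is that close to [x]
   contains [x] and stays in the [e]-ball. *)
have [k] := @ltr_add_invr R 0%R (e%:num / 2) (divr_gt0 (gt0 e) (ltr0n R 2)).
rewrite add0r => ke.
have k0 : 0 < k.+1%:R^-1 :> R by rewrite invr_gt0.
have approx i j : exists q : rat, ball (x i j) k.+1%:R^-1 (ratr q).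
  have /rat_in_itvoo[q] : x i j - k.+1%:R^-1 < x i j + k.+1%:R^-1.
    by rewrite ltrD2l (lt_trans _ k0) // oppr_lt0.
  rewrite in_itv /= => /andP[q1 q2]; exists q => //.
  by rewrite -ball_normE /= ltr_distlC q1.
have [q xq] : exists q, ball x k.+1%:R^-1 (map_mx ratr q : 'M[R]_(m, n)).
  exists (\matrix_(i, j) sval (cid (approx i j))); split=> // i j.
  by rewrite !mxE; case: cid.
exists (b (q, k)); first by split; [exists (q, k)|exact: ball_sym].
move=> z bz; apply: eV => /=; rewrite [e%:num]splitr.
apply: (@ball_triangle _ _ (map_mx ratr q : 'M[R]_(m, n))).
  exact: le_ball (ltW ke) _ xq.
exact: le_ball (ltW ke) _ bz.
Qed.

Lemma hausdorff_inj M N (h : M -> N) :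
  continuous h -> injective h -> hausdorff_space N -> hausdorff_space M.
Proof.
move=> ch ih hN x y xy; apply: ih; apply: hN => A B Ax By.
by have [z [Az Bz]] := xy _ _ (ch _ _ Ax) (ch _ _ By); exists (h z).
Qed.

Lemma hausdorff_prod M N :
  hausdorff_space M -> hausdorff_space N -> hausdorff_space (M * N)%type.
Proof.
move=> hM hN [x y] [x' y'] xy; congr (_, _).
  apply: hM => A B Ax By.
  have [||[z w] [Az Bz]] := xy (fst @^-1` A) (fst @^-1` B).
  - by apply: (@cvg_fst _ _ (nbhs x)).
  - by apply: (@cvg_fst _ _ (nbhs x')).
  by exists z.
apply: hN => A B Ax By.
have [||[z w] [Az Bz]] := xy (snd @^-1` A) (snd @^-1` B).
- by apply: (@cvg_snd _ _ _ (nbhs y)).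
- by apply: (@cvg_snd _ _ _ (nbhs y')).
by exists w.
Qed.

End topology.

(** * Manifolds *)

Section atlases.
Context {R : realType}.
Implicit Types (M N : topologicalType) (E F : normedModType R).

Definition charted M E (A : atlas M E) := forall p, is_chart (A p) /\ dom (A p) p.

Lemma open_fwd M E (c : chart M E) (U : set M) :
  is_chart c -> open U -> open (fwd c @` (dom c `&` U)).
Proof.
move=> [odom oimg fwdK cfwd cbwd] oU; rewrite openE => _ [x [xc Ux] <-].
have fx : (fwd c @` dom c) (fwd c x) by exists x.
have bU : nbhs (fwd c x) (bwd c @^-1` U).
  by apply: cbwd; rewrite ?fwdK //; exact: open_nbhs_nbhs.
have : nbhs (fwd c x) (fwd c @` dom c `&` bwd c @^-1` U).
  by apply: filterI bU; exact: open_nbhs_nbhs.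
apply: filterS => _ [[y yc <-]] /=; rewrite fwdK // => Uy.
by exists y.
Qed.

Lemma charted_vec E : charted (vec_atlas E).
Proof.
move=> p; split=> //; split=> //=; [exact: openT|by rewrite image_id; exact: openT|..].
- by move=> x _; exact: cvg_id.
- by move=> x _; exact: cvg_id.
Qed.

Lemma manifold_vec E : @second_countable E -> manifold (vec_atlas E).
Proof.
move=> cE; split=> //.
  exact: charted_vec.
(* The only transition map is the identity, written as an affine map. *)
move=> p q k; rewrite (_ : _ \o _ = (fun x : E => x + 0)).
  by apply: (@Ck_affine _ _ _ _ _ id) => // x; exact: cvg_id.
by apply/funext => x; rewrite addr0.
Qed.

Lemma image_prod (T1 T2 U1 U2 : Type) (f : T1 -> U1) (g : T2 -> U2) A B :
  (fun x => (f x.1, g x.2)) @` (A `*` B) = (f @` A) `*` (g @` B).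
Proof.
apply/seteqP; split=> [_ [[x y] [Ax By] <-]|[_ _] [] [x Ax] /= <- [y By] /= <-].
  by split; [exists x|exists y].
by exists (x, y).
Qed.

Lemma charted_prod M N E F (A : atlas M E) (B : atlas N F) :
  charted A -> charted B -> charted (prod_atlas A B).
Proof.
move=> cA cB [p q]; have [[dA iA fK1 c1 b1] p1] := cA p.
have [[dB iB fK2 c2 b2] q2] := cB q.
split=> //; split=> /=.
- exact: open_setX.
- by rewrite image_prod; exact: open_setX.
- by move=> [x y] [] /= ? ?; rewrite fK1 // fK2.
- move=> [x y] [] /= xA yB; apply: cvg_pair.
    by apply: (cvg_comp _ _ cvg_fst); exact: c1.
  by apply: (cvg_comp _ _ cvg_snd); exact: c2.
- move=> _ [[x y] [/= xA yB] <-]; apply: cvg_pair.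
    by apply: (cvg_comp _ _ cvg_fst); by apply: b1; exists x.
  by apply: (cvg_comp _ _ cvg_snd); by apply: b2; exists y.
Qed.

Lemma manifold_prod M N E F (A : atlas M E) (B : atlas N F) :
  manifold A -> manifold B -> manifold (prod_atlas A B).
Proof.
move=> [hM sM cA tA] [hN sN cB tB]; split.
- exact: hausdorff_prod.
- exact: second_countable_prod.
- exact: charted_prod.
move=> [p1 p2] [q1 q2] k.
(* The domain of a product transition map is the product of the two domains, and the map is the pair
   of the factor transitions precomposed with the projections. *)
pose S := (fwd (A p1) @` (dom (A p1) `&` dom (A q1))) `*`
          (fwd (B p2) @` (dom (B p2) `&` dom (B q2))).
have -> : fwd (prod_atlas A B (p1, p2)) @`
    (dom (prod_atlas A B (p1, p2)) `&` dom (prod_atlas A B (q1, q2))) = S.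
  rewrite /S -image_prod; congr (_ @` _); apply/seteqP.
  by split=> -[x y] /= [[? ?] [? ?]].
have oS : open S.
  have [[[? _ _ _ _] _] [[? _ _ _ _] _]] := (cA q1, cB q2).
  by apply: open_setX; apply: open_fwd => //; [case: (cA p1)|case: (cB p2)].
apply: (@Ck_pair _ _ _ _ _ _ ((fwd (A q1) \o bwd (A p1)) \o fst)
                             ((fwd (B q2) \o bwd (B p2)) \o snd)) => //.
  apply: Ck_comp_linear (tA p1 q1 k) => //; first by move=> x; exact: cvg_fst.
  by move=> x [].
apply: Ck_comp_linear (tB p2 q2 k) => //; first by move=> x; exact: cvg_snd.
by move=> x [].
Qed.

(** The smooth structure for which the identification [h], with inverse [k], is a diffeomorphism:
    the transition maps are those of [B], because [h \o k] cancels between charts. *)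
Definition transport_atlas M N F (h : M -> N) (k : N -> M) (B : atlas N F) :
    atlas M F :=
  fun p => Chart (h @^-1` dom (B (h p))) (fwd (B (h p)) \o h)
                 (k \o bwd (B (h p))).

Lemma image_transport M N T (h : M -> N) (k : N -> M) (f : N -> T) D :
  cancel k h -> (f \o h) @` (h @^-1` D) = f @` D.
Proof.
move=> kh; apply/seteqP; split=> [_ [x Dx <-]|_ [y Dy <-]]; first by exists (h x).
by exists (k y) => /=; rewrite kh.
Qed.

Lemma charted_transport M N F (h : M -> N) (k : N -> M) (B : atlas N F) :
  continuous h -> continuous k -> cancel h k -> cancel k h ->
  charted B -> charted (transport_atlas h k B).
Proof.
move=> ch ck hk kh cB p; have [[dB iB fK c b] hp] := cB (h p).
split=> //; split=> /=.
- by move/continuousP: ch; exact.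
- by rewrite (image_transport _ _ kh).
- by move=> x xB; rewrite fK.
- by move=> x xB; apply: continuous_comp (ch x) (c _ xB).
- move=> _ [x xB <-]; apply: continuous_comp (ck _).
  by apply: b; exists (h x).
Qed.

Lemma manifold_transport M N F (h : M -> N) (k : N -> M) (B : atlas N F) :
  continuous h -> continuous k -> cancel h k -> cancel k h ->
  manifold B -> manifold (transport_atlas h k B).
Proof.
move=> ch ck hk kh [hN sN cB tB]; split.
- exact: hausdorff_inj ch (can_inj hk) hN.
- exact: second_countable_homeo ch ck hk sN.
- exact: charted_transport.
move=> p q i; have := tB (h p) (h q) i.
rewrite /= -[h @^-1` _ `&` _]preimage_setI (image_transport _ _ kh).
congr Ck; apply/funext => y /=; by rewrite kh.
Qed.

(* [c] may depend on the base point because the charts at [p] and [f p] do. *)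
Lemma smooth_map_affine M N E F (A : atlas M E) (B : atlas N F) (f : M -> N)
    (L : E -> F) (c : M -> F) :
  charted A -> charted B -> continuous f -> linear L -> continuous L ->
  (forall p x, dom (A p) x -> dom (B (f p)) (f x) ->
     fwd (B (f p)) (f x) = L (fwd (A p) x) + c p) ->
  smooth_map A B f /\ forall p, tangent A B f p = L.
Proof.
move=> cA cB cf linL cL fL.
pose U p := fwd (A p) @` (dom (A p) `&` f @^-1` dom (B (f p))).
have oU p : open (U p).
  apply: open_fwd; first by case: (cA p).
  by have [[odom _ _ _ _] _] := cB (f p); move/continuousP: cf; exact.
have fE p : {in U p, (fun y => L y + c p) =1 loc_repr A B f p}.
  move=> _ /set_mem[x [xA xB] <-]; have [[_ _ fK _ _] _] := cA p.
  by rewrite /loc_repr /= fK // fL.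
split.
  split=> // p k; apply: Ck_eq (oU p) (fE p) _; exact: Ck_affine.
move=> p; have [dL <-] := affine_diff (c p) linL cL (fwd (A p) p).
(* The tangent map sees only the germ at [fwd (A p) p], and [U p] is a neighbourhood of that
   point. *)
have near_p : 
      \forall y \near fwd (A p) p, L y + c p = loc_repr A B f p y.
  have : nbhs (fwd (A p) p) (U p).
    apply: open_nbhs_nbhs; split => //; exists p => //.
    by split; [case: (cA p)|case: (cB (f p))].
  by apply: filterS => y yU; apply: fE; exact: mem_set.
by case: (near_eq_diff near_p dL).
Qed.

End atlases.

(** * Continuity of maps built from tuples, projections and sums *)

Section continuity.
Context {T U V : topologicalType}.

Lemma continuous_pair (f : T -> U) (g : T -> V) :
  continuous f -> continuous g -> continuous (fun x => (f x, g x)).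
Proof. by move=> cf cg x; apply: cvg_pair; [exact: cf|exact: cg]. Qed.

Lemma continuous_fst (f : T -> U * V) :
  continuous f -> continuous (fun x => (f x).1).
Proof. by move=> cf x; apply: continuous_comp (cf x) _; exact: cvg_fst. Qed.

Lemma continuous_snd (f : T -> U * V) :
  continuous f -> continuous (fun x => (f x).2).
Proof. by move=> cf x; apply: continuous_comp (cf x) _; exact: cvg_snd. Qed.

End continuity.

Lemma continuous_add {R : realType} (T : topologicalType) (V : normedModType R)
  (f g : T -> V) : continuous f -> continuous g -> continuous (fun x => f x + g x).
Proof. by move=> cf cg x; apply: cvgD; [exact: cf|exact: cg]. Qed.

(** Works on the syntax of the map, which is why maps given by pattern matching are first rewritten
    with explicit projections. Other constituents, such as scalar multiplication, are left as
    goals. *)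
Ltac prove_continuous :=
  repeat match goal with
  | |- forall x, continuous_at x (fun z => (@?f z, @?g z)) =>
      apply: (@continuous_pair _ _ _ f g)
  | |- forall x, continuous_at x (fun z => (@?f z).1) =>
      apply: (@continuous_fst _ _ _ f)
  | |- forall x, continuous_at x (fun z => (@?f z).2) =>
      apply: (@continuous_snd _ _ _ f)
  | |- forall x, continuous_at x (fun z => @?f z + @?g z) =>
      apply: (@continuous_add _ _ _ f g)
  | |- forall x, continuous_at x (fun z => z) => by move=> ?; exact: cvg_id
  | |- forall x, continuous_at x (fun _ => ?c) => by move=> ?; exact: cvg_cst
  end.

(** * The pairing of the Lie algebra with its dual *)

Section pairing.
Context {R : realType} {n : nat}.
Implicit Types (mu nu : 'cV[R]_n) (xi : 'rV[R]_n).

Lemma pairing0l xi : pairing 0 xi = 0.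
Proof. by rewrite /pairing mulmx0 mxE. Qed.

Lemma pairing0r mu : pairing mu 0 = 0.
Proof. by rewrite /pairing mul0mx mxE. Qed.

Lemma pairing_linear xi : linear (fun mu => pairing mu xi : R^o).
Proof. by move=> a mu nu; rewrite /pairing mulmxDr -scalemxAr !mxE. Qed.

Lemma pairing_continuous xi : continuous (fun mu => pairing mu xi : R^o).
Proof.
rewrite (_ : (fun _ => _) = fun mu => \sum_i xi 0 i * mu i 0); last first.
  by apply/funext => mu; rewrite /pairing mxE.
move=> mu; apply: (@cvg_big R^o 'I_n +%R 0 xpredT (@add_continuous R^o) _ (nbhs mu)) => i _.
by apply: cvgM; [exact: cvg_cst|exact: coord_continuous].
Qed.

End pairing.

(** * Hamiltonian action *)

Section tulczyjew.
Context {R : realType} {n : nat} (G : lieGroupType R n).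
Local Notation g := 'rV[R]_n.
Local Notation g' := 'cV[R]_n.
Local Notation A := (@lie_atlas R n G).
Local Notation P := (G * g' * g * g')%type.
Local Notation E := (g * g' * g * g')%type.

Lemma charted_lie : charted A.
Proof. by have [] := @lie_manifold R n G. Qed.

Lemma charted_cotangent : charted (cotangent_atlas G).
Proof. exact: charted_prod charted_lie (@charted_vec _ _). Qed.

Lemma charted_tulczyjew : charted (tulczyjew_atlas G).
Proof.
by do !apply: charted_prod; [exact: charted_lie|exact: charted_vec..].
Qed.

(** ['d] yields a linear map by construction, hence so does [right_triv]. *)
Lemma right_triv0 (h : G) : right_triv h 0 = 0.
Proof. exact: linear0. Qed.

(* The differentiated curve is constant because t *: 0 = 0, whatever [lie_exp 0] is. *)
Lemma bracket0 (eta : g) : bracket G 0 eta = 0.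
Proof.
rewrite /bracket (_ : (fun _ => _) = fun=> Ad (lie_exp G 0) eta).
  exact: derive_cst.
by apply/funext => t; rewrite scaler0.
Qed.

(** Translation fixes the group factor, so a point and its image use the same chart of [G], and the
    action is linear in coordinates. *)
Lemma action_translate_smooth :
  smooth_map (prod_atlas (tulczyjew_atlas G) (vec_atlas g)) (tulczyjew_atlas G)
    (fun z : P * g => translate G z.1 z.2).
Proof.
have -> : (fun z : P * g => translate G z.1 z.2) = fun z =>
    (z.1.1.1.1, z.1.1.1.2, z.1.1.2 + z.2, z.1.2).
  by apply/funext => -[[[[]]]].
have [||||||//] := @smooth_map_affine R (P * g)%type P (E * g)%type E
   (prod_atlas (tulczyjew_atlas G) (vec_atlas g)) (tulczyjew_atlas G)
   (fun z : P * g => (z.1.1.1.1, z.1.1.1.2, z.1.1.2 + z.2, z.1.2))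
   (fun u => (u.1.1.1.1, u.1.1.1.2, u.1.1.2 + u.2, u.1.2)) (fun=> 0).
- exact: charted_prod charted_tulczyjew (@charted_vec _ _).
- exact: charted_tulczyjew.
- by prove_continuous.
- move=> a [[[[u1 u2] u3] u4] u5] [[[[v1 v2] v3] v4] v5].
  congr (_, _, _, _); rewrite -[LHS]/(a *: u3 + v3 + (a *: u5 + v5)).
  by rewrite addrACA -scalerDr.
- by prove_continuous.
- by move=> p x _ _; rewrite addr0.
Qed.

Lemma tangent_translate eta p :
  tangent (tulczyjew_atlas G) (tulczyjew_atlas G) (translate G ^~ eta) p = id.
Proof.
have -> : translate G ^~ eta = fun z : P => (z.1.1.1, z.1.1.2, z.1.2 + eta, z.2).
  by apply/funext => -[[[]]].
have [||||||_ ->//] := @smooth_map_affine R P P E E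
   (tulczyjew_atlas G) (tulczyjew_atlas G)
   (fun z : P => (z.1.1.1, z.1.1.2, z.1.2 + eta, z.2)) id
   (fun=> (0, 0, eta, 0)).
- exact: charted_tulczyjew.
- exact: charted_tulczyjew.
- by prove_continuous.
- by [].
- by prove_continuous.
- by move=> q x _ _; congr (_, _, _, _); rewrite /= addr0.
Qed.

(** The linear map [f] covers two uses at once: the identity for smoothness of the momentum map, and
    the pairing with [eta] for its components. *)
Lemma momentum_affine (V : normedModType R) (f : g' -> V) :
  linear f -> continuous f ->
  smooth_map (tulczyjew_atlas G) (vec_atlas V) (fun p => f (momentum G p)) /\
  forall p, tangent (tulczyjew_atlas G) (vec_atlas V)
              (fun p => f (momentum G p)) p = fun u => f u.1.1.2.
Proof.
move=> linf cf.
have -> : (fun p => f (momentum G p)) = fun p : P => f p.1.1.2.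
  by apply/funext => -[[[]]].
have cf' (T : topologicalType) (k : T -> g') : continuous k -> continuous (f \o k).
  by move=> ck x; apply: continuous_comp (ck x) (cf _).
apply: (@smooth_map_affine R P V E V (tulczyjew_atlas G) (vec_atlas V)
  (fun p : P => f p.1.1.2) (fun u => f u.1.1.2) (fun=> 0)).
- exact: charted_tulczyjew.
- exact: charted_vec.
- by apply: cf'; prove_continuous.
- by move=> a u v; exact: linf.
- by apply: cf'; prove_continuous.
- by move=> q x _ _; rewrite addr0.
Qed.

Lemma generator_translate eta p :
  generator (tulczyjew_atlas G) (translate G) eta p = (0, 0, eta, 0).
Proof.
move: p => [[[h mu] xi] nu]; rewrite /generator.
have [||||||_ ->] := @smooth_map_affine R R^o P R^o E
   (vec_atlas R^o) (tulczyjew_atlas G)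
   (fun t : R^o => (h, mu, xi + t *: eta, nu)) (fun t => (0, 0, t *: eta, 0))
   (* The orbit curve is a straight line in the chart: this constant is its starting point, and the
      velocity is the linear part at 1. *)
   (fun=> (fwd (A h) h, mu, xi, nu)).
- exact: charted_vec.
- exact: charted_tulczyjew.
- by prove_continuous; exact: scalel_continuous.
- move=> a s t; congr (_, _, _, _); rewrite /= ?scaler0 ?addr0 //.
  by rewrite scalerDl scalerA.
- by prove_continuous; exact: scalel_continuous.
- move=> t s _ _; congr (_, _, _, _); rewrite /= ?add0r //.
  by rewrite addrC.
by rewrite scale1r.
Qed.

Lemma momentum_map_translate :
  momentum_map (tulczyjew_atlas G) (tulczyjew_form G) (translate G) (momentum G).
Proof.
split.
- exact: action_translate_smooth.
(* The form does not depend on the coordinate [xi], and the tangent map of a translation is the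
   identity. *)
- move=> eta; apply/funext => p; apply/funext => u; apply/funext => v.
  by rewrite /pullback tangent_translate; move: p => [[[h mu] xi] nu].
- have [||//] := @momentum_affine g' id; [by []|by prove_continuous].
- by move=> [[[h mu] xi] nu].
move=> p eta v; rewrite generator_translate.
have [_ ->] := momentum_affine (pairing_linear eta) (@pairing_continuous _ _ eta).
move: p => [[[h mu] xi] nu]; rewrite /tulczyjew_form /= right_triv0 bracket0.
by rewrite pairing0l !pairing0r pairing0l !(subr0, addr0) sub0r.
Qed.

End tulczyjew.
(** * Reduction *)

Section reduction.
Context {R : realType} {n : nat} (G : lieGroupType R n) (mu : 'cV[R]_n).
Local Notation g := 'rV[R]_n.
Local Notation g' := 'cV[R]_n.
Local Notation A := (@lie_atlas R n G).
Local Notation P := (G * g' * g * g')%type.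
Local Notation E := (g * g' * g * g')%type.
Local Notation L := (level (momentum G) mu).
Local Notation Q := (reduced_space (translate G) (momentum G) mu).
Local Notation incl := (@level_incl R n P (momentum G) mu).
Local Notation proj := (@reduced_proj R n P (translate G) (momentum G) mu).

Definition level_coord (x : L) : G * g * g' :=
  ((incl x).1.1.1, (incl x).1.2, (incl x).2).

Definition level_point (y : G * g * g') : L :=
  exist _ (y.1.1, mu, y.1.2, y.2) (mem_set (erefl mu)).

Lemma level_inclE x :
  incl x = ((level_coord x).1.1, mu, (level_coord x).1.2, (level_coord x).2).
Proof.
have : momentum G (incl x) = mu := set_mem (valP x).
by rewrite /level_coord; case: (incl x) => -[[h ?] xi] nu /= ->.
Qed.

Lemma level_coordK : cancel level_coord level_point.
Proof. by move=> x; apply: val_inj; rewrite -[RHS]/(incl x) [RHS]level_inclE. Qed.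

Lemma level_pointK : cancel level_point level_coord.
Proof. by move=> [[]]. Qed.

Lemma continuous_level_incl : continuous incl.
Proof. exact: initial_continuous. Qed.

Lemma continuous_level_coord : continuous level_coord.
Proof.
move: continuous_level_incl => ci; rewrite /level_coord.
by prove_continuous; exact: ci.
Qed.

Lemma continuous_level_point : continuous level_point.
Proof.
apply: continuous_comp_initial.
rewrite (_ : _ \o _ = fun y => (y.1.1, mu, y.1.2, y.2)) //.
by prove_continuous.
Qed.

(** Read off an arbitrary representative; [reduced_coord_proj] shows that the choice is
    immaterial. *)
Definition reduced_coord (q : Q) : G * g' :=
  let x := level_coord (repr q) in (x.1.1, x.2).

(** The points with [xi = 0] form a global slice, meeting each orbit exactly once. *)
Definition reduced_point (y : G * g') : Q := proj (level_point (y.1, 0, y.2)).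

(** The chosen representative and [x] differ by a translation, which moves only [xi]. *)
Lemma reduced_coord_proj x :
  reduced_coord (proj x) = ((level_coord x).1.1, (level_coord x).2).
Proof.
have /eqmodP/asboolP[eta] := reprK (proj x).
rewrite /reduced_coord /level_coord.
by case: (incl (repr _)) => -[[h ?] xi] nu /= <-.
Qed.

Lemma reduced_point_coord_proj x : reduced_point (reduced_coord (proj x)) = proj x.
Proof.
rewrite reduced_coord_proj; apply/eqmodP/asboolP.
(* Translating the slice point by the [xi] of [x] leads to [x]. *)
exists (level_coord x).1.2.
by rewrite [RHS]level_inclE /= add0r.
Qed.

Lemma reduced_coordK : cancel reduced_coord reduced_point.
Proof. by move=> q; rewrite -[q]reprK; exact: reduced_point_coord_proj. Qed.

Lemma reduced_pointK : cancel reduced_point reduced_coord.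
Proof. by move=> [h nu]; rewrite /reduced_point reduced_coord_proj. Qed.

Lemma continuous_reduced_proj : continuous proj.
Proof. exact: pi_continuous. Qed.

(** [repr] need not be continuous; by the universal property of the quotient topology it suffices to
    compose with the projection, where [repr] disappears. *)
Lemma continuous_reduced_coord : continuous reduced_coord.
Proof.
apply/quotient_continuous.
rewrite (_ : _ \o _ = fun x => ((level_coord x).1.1, (level_coord x).2)).
  by prove_continuous; exact: continuous_level_coord.
by apply/funext => x; exact: reduced_coord_proj.
Qed.

Lemma continuous_reduced_point : continuous reduced_point.
Proof.
have c0 : continuous (fun y : G * g' => (y.1, 0 : g, y.2)) by prove_continuous.
have c1 : continuous (level_point \o (fun y : G * g' => (y.1, 0 : g, y.2))).
  by move=> y; apply: continuous_comp (c0 y) _; exact: continuous_level_point.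
by move=> y; apply: continuous_comp (c1 y) _; exact: continuous_reduced_proj.
Qed.

(** * Smooth structures on the level set and on the quotient *)

Definition level_atlas : atlas L (g * g * g')%type :=
  transport_atlas level_coord level_point
    (prod_atlas (prod_atlas A (vec_atlas g)) (vec_atlas g')).

Definition reduced_atlas : atlas Q (g * g')%type :=
  transport_atlas reduced_coord reduced_point (cotangent_atlas G).

Lemma manifold_level : manifold level_atlas.
Proof.
apply: manifold_transport continuous_level_coord continuous_level_point
  level_coordK level_pointK _.
apply: manifold_prod (manifold_vec (second_countable_mx _ _ _)).
apply: manifold_prod (manifold_vec (second_countable_mx _ _ _)).
exact: lie_manifold.
Qed.

Lemma manifold_reduced : manifold reduced_atlas.
Proof.
apply: manifold_transport continuous_reduced_coord continuous_reduced_point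
  reduced_coordK reduced_pointK _.
apply: manifold_prod (manifold_vec (second_countable_mx _ _ _)).
exact: lie_manifold.
Qed.

Lemma charted_level : charted level_atlas.
Proof. by case: manifold_level. Qed.

Lemma charted_reduced : charted reduced_atlas.
Proof. by case: manifold_reduced. Qed.

Lemma level_incl_affine :
  smooth_map level_atlas (tulczyjew_atlas G) incl /\
  forall x, tangent level_atlas (tulczyjew_atlas G) incl x =
            fun u => (u.1.1, 0, u.1.2, u.2).
Proof.
apply: (@smooth_map_affine R L P (g * g * g')%type E level_atlas
  (tulczyjew_atlas G) incl (fun u => (u.1.1, 0, u.1.2, u.2))
  (* The fixed momentum is the translation part, so tangent vectors of the level set have zero in
     that slot. *)
  (fun=> (0, mu, 0, 0))).
- exact: charted_level.
- exact: charted_tulczyjew.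
- exact: continuous_level_incl.
- move=> a [[u1 u2] u3] [[v1 v2] v3].
  have zeroE : 0 = a *: 0 + 0 :> g' by rewrite scaler0 addr0.
  by congr (_, _, _, _); exact: zeroE.
- by prove_continuous.
- move=> p x _ _; rewrite (level_inclE x).
  have pairE (h : g) (xi : g) (nu : g') :
      (h, mu, xi, nu) = (h, 0, xi, nu) + (0, mu, 0, 0).
    by congr (_, _, _, _); rewrite ?addr0 ?add0r.
  exact: pairE.
Qed.

Lemma reduced_proj_affine :
  smooth_map level_atlas reduced_atlas proj /\
  forall x, tangent level_atlas reduced_atlas proj x = fun u => (u.1.1, u.2).
Proof.
apply: (@smooth_map_affine R L Q (g * g * g')%type (g * g')%type level_atlas
  reduced_atlas proj (fun u => (u.1.1, u.2)) (fun=> 0)).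
- exact: charted_level.
- exact: charted_reduced.
- exact: continuous_reduced_proj.
- by [].
- by prove_continuous.
(* A chart of the quotient is by definition a cotangent chart read through [reduced_coord]; once
   this is computed on projected points, both sides use the same chart of [G]. *)
- move=> p x _ _; rewrite addr0 -[LHS]/(fwd
    (cotangent_atlas G (reduced_coord (proj p))) (reduced_coord (proj x))).
  by rewrite !reduced_coord_proj.
Qed.

Lemma reduced_coord_affine :
  smooth_map reduced_atlas (cotangent_atlas G) reduced_coord /\
  forall q, tangent reduced_atlas (cotangent_atlas G) reduced_coord q = id.
Proof.
apply: (@smooth_map_affine R Q (G * g')%type (g * g')%type (g * g')%type
  reduced_atlas (cotangent_atlas G) reduced_coord id (fun=> 0)).
- exact: charted_reduced.
- exact: charted_cotangent.
- exact: continuous_reduced_coord.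
- by [].
- by prove_continuous.
- by move=> p x _ _; rewrite addr0.
Qed.

Lemma reduced_point_smooth :
  smooth_map (cotangent_atlas G) reduced_atlas reduced_point.
Proof.
have [||||||//] := @smooth_map_affine R (G * g')%type Q (g * g')%type
  (g * g')%type (cotangent_atlas G) reduced_atlas reduced_point id (fun=> 0).
- exact: charted_cotangent.
- exact: charted_reduced.
- exact: continuous_reduced_point.
- by [].
- by prove_continuous.
- move=> p x _ _; rewrite addr0 -[LHS]/(fwd
    (cotangent_atlas G (reduced_coord (reduced_point p)))
    (reduced_coord (reduced_point x))).
  by rewrite !reduced_pointK.
Qed.

(** Defined as a pullback, so that the comparison with the canonical form is immediate and the
    content lies in the reduction identity on the level set. *)
Definition reduced_two_form : form2 Q (g * g')%type :=
  pullback reduced_atlas (cotangent_atlas G) reduced_coord (canonical_form G).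

Lemma symplectic_reduction_level :
  symplectic_reduction (tulczyjew_atlas G) (tulczyjew_form G)
    level_atlas reduced_atlas reduced_two_form.
Proof.
have [sI tI] := level_incl_affine; have [sQ tQ] := reduced_proj_affine.
split.
- exact: manifold_level.
- exact: sI.
- by move=> x; rewrite tI => -[[u1 u2] u3] [[v1 v2] v3] [-> -> ->].
- exact: manifold_reduced.
- exact: sQ.
(* A vector of the quotient is lifted along the slice, with zero [xi] component. *)
- by move=> x w; rewrite tQ; exists (w.1, 0, w.2); case: w.
apply/funext => x; apply/funext => u; apply/funext => v.
rewrite /pullback tI tQ /reduced_two_form /pullback reduced_coord_affine.2.
rewrite reduced_coord_proj level_inclE /=.
by rewrite !pairing0l addr0 subr0.
Qed.

End reduction.

Unset Implicit Arguments.

Theorem proposition6p8 (R : realType) (n : nat) (G : lieGroupType R n) :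
  momentum_map (tulczyjew_atlas G) (tulczyjew_form G) (translate G) (momentum G) /\
  forall mu : 'cV[R]_n,
    exists (AL : atlas (level (momentum G) mu) ('rV[R]_n * 'rV[R]_n * 'cV[R]_n)%type)
      (AQ : atlas (reduced_space (translate G) (momentum G) mu)
                  ('rV[R]_n * 'cV[R]_n)%type)
      (omega : form2 (reduced_space (translate G) (momentum G) mu)
                     ('rV[R]_n * 'cV[R]_n)%type),
      symplectic_reduction (tulczyjew_atlas G) (tulczyjew_form G) AL AQ omega /\
      exists F : reduced_space (translate G) (momentum G) mu -> G * 'cV[R]_n,
        [/\ forall x : level (momentum G) mu,
              F (reduced_proj (translate G) x) =
              let: (g, _, _, nu) := level_incl x in (g, nu),
            diffeomorphism AQ (cotangent_atlas G) F &
            pullback AQ (cotangent_atlas G) F (canonical_form G) = omega].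

Proof.
split=> [|mu]; first exact: momentum_map_translate.
exists (@level_atlas R n G mu), (@reduced_atlas R n G mu), (@reduced_two_form R n G mu).
split; first exact: symplectic_reduction_level.
(* The last clause, on the forms, is the definition of [reduced_two_form]. *)
exists (@reduced_coord R n G mu); split=> [x||]; last by [].
  by rewrite reduced_coord_proj [level_incl x]level_inclE.
split; first by case: (reduced_coord_affine G mu).
exists (@reduced_point R n G mu); split.
- exact: reduced_point_smooth.
- exact: reduced_coordK.
- exact: reduced_pointK.
Qed.
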